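(* Let $\mathbb{H}$ be the quaternions, where $(x_0,x_1,x_2,x_3)$ denotes $x_0+x_1 i+x_2 j+x_3 k$, and consider the following unit quaternions (which together with $q_0=1$ are the vertices of a regular 4-dimensional simplex): $$q_1=\left(-\tfrac14,\tfrac{\sqrt5}{4},\tfrac{\sqrt5}{4},\tfrac{\sqrt5}{4}\right),\quad q_2=\left(-\tfrac14,-\tfrac{\sqrt5}{4},-\tfrac{\sqrt5}{4},\tfrac{\sqrt5}{4}\right),$$ $$q_3=\left(-\tfrac14,\tfrac{\sqrt5}{4},-\tfrac{\sqrt5}{4},-\tfrac{\sqrt5}{4}\right),\quad q_4=\left(-\tfrac14,-\tfrac{\sqrt5}{4},\tfrac{\sqrt5}{4},-\tfrac{\sqrt5}{4}\right).$$ Then $q_1,q_2,q_3,q_4$ are free generators of a free group under quaternion multiplication; that is, the group homomorphism from the free group on four generators $g_1,g_2,g_3,g_4$ to $\mathbb{H}^\times$ sending $g_i\mapsto q_i$ for $i=1,2,3,4$ is injective.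
   Context: $\mathbb{H}$ is the algebra of Hamilton quaternions with the standard basis $1,i,j,k$ and the usual multiplication ($i^2=j^2=k^2=ijk=-1$). *)

(* Defs.v *)
From HB Require Import structures.
From mathcomp Require Import all_boot all_order all_algebra.
From mathcomp Require Import ring lra.
From mathcomp Require Import reals.

Set Implicit Arguments.
Unset Strict Implicit.
Unset Printing Implicit Defensive.

Import Order.TTheory GRing.Theory Num.Theory.
Local Open Scope ring_scope.

(* A letter (x, false) stands for the generator x, (x, true) for its inverse; *)
(* the elements of the free group are the reduced words.                      *)
Section FreeGroup.
Variable T : choiceType.
Implicit Types (a b : T * bool) (u v w : seq (T * bool)).

Definition letter_inv a := (a.1, ~~ a.2).

Definition reduced w := sorted (fun a b => b != letter_inv a) w.

Record free_group := FreeGroup { fg_word :> seq (T * bool); _ : reduced fg_word }.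

HB.instance Definition _ := [isSub for fg_word].
HB.instance Definition _ := [Choice of free_group by <:].

Definition push a w :=
  if w is b :: w' then if b == letter_inv a then w' else a :: w else [:: a].

Definition reduced_cat u v := foldr push v u.

Definition word_inv w := rev (map letter_inv w).

Lemma letter_invK : involutive letter_inv.
Proof. by case=> x b; rewrite /letter_inv /= negbK. Qed.

Lemma reduced_behead a w : reduced (a :: w) -> reduced w.
Proof. exact: path_sorted. Qed.

Lemma push_reduced a w : reduced w -> reduced (push a w).
Proof.
case: w => [//|b w] rw /=.
by case: eqP => [_|/eqP ne]; [exact: reduced_behead rw | rewrite /reduced /= ne].
Qed.

Lemma push_cons a w : reduced (a :: w) -> push a w = a :: w.
Proof. by case: w => [//|b w] /=; rewrite /reduced /= => /andP[/negbTE ->]. Qed.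

Lemma pushK a w : reduced w -> push (letter_inv a) (push a w) = w.
Proof.
case: w => [|b w] rw /=; first by rewrite letter_invK eqxx.
case: eqP => [eb|_] /=; last by rewrite letter_invK eqxx.
by rewrite push_cons -eb.
Qed.

Lemma reduced_cat_reduced u v : reduced v -> reduced (reduced_cat u v).
Proof. by move=> rv; elim: u => //= a u; apply: push_reduced. Qed.

Lemma reduced_cat_push a u v : reduced v ->
  reduced_cat (push a u) v = push a (reduced_cat u v).
Proof.
move=> rv; case: u => [//|b u] /=; case: eqP => [->|//].
have := pushK (letter_inv a) (reduced_cat_reduced u rv).
by rewrite letter_invK => ->.
Qed.

Lemma reduced_catA u v w : reduced w ->
  reduced_cat u (reduced_cat v w) = reduced_cat (reduced_cat u v) w.
Proof. by move=> rw; elim: u => //= a u ->; rewrite reduced_cat_push. Qed.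

Lemma reduced_cats0 u : reduced u -> reduced_cat u [::] = u.
Proof.
by elim: u => //= a u IHu ru; rewrite IHu ?push_cons //; apply: reduced_behead ru.
Qed.

Lemma reduced_catV u : reduced u -> reduced_cat (word_inv u) u = [::].
Proof.
rewrite /word_inv /reduced_cat; elim: u => [//|a u IHu] ru /=.
rewrite rev_cons foldr_rcons -(push_cons ru) pushK ?IHu //;
by apply: reduced_behead ru.
Qed.

Lemma word_invK : involutive word_inv.
Proof.
by move=> u; rewrite /word_inv map_rev revK -map_comp map_id_in // => a _ /=;
   rewrite letter_invK.
Qed.

Lemma word_inv_reduced w : reduced w -> reduced (word_inv w).
Proof.
rewrite /reduced /word_inv rev_sorted sorted_map.
apply: sub_sorted => a b /=; apply: contraNneq => /(can_inj letter_invK) ->.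
by rewrite letter_invK.
Qed.

Lemma fg_wordP (w : free_group) : reduced w. Proof. exact: valP. Qed.

Definition fg_one := @FreeGroup [::] isT.
Definition fg_mul (u v : free_group) :=
  FreeGroup (reduced_cat_reduced u (fg_wordP v)).
Definition fg_inv (u : free_group) := FreeGroup (word_inv_reduced (fg_wordP u)).

Lemma fg_mulA : associative fg_mul.
Proof. by move=> u v w; apply/val_inj/reduced_catA/fg_wordP. Qed.
Lemma fg_mul1g : left_id fg_one fg_mul.
Proof. by move=> u; apply: val_inj. Qed.
Lemma fg_mulg1 : right_id fg_one fg_mul.
Proof. by move=> u; apply/val_inj/reduced_cats0/fg_wordP. Qed.
Lemma fg_mulVg : left_inverse fg_one fg_inv fg_mul.
Proof. by move=> u; apply/val_inj/reduced_catV/fg_wordP. Qed.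
Lemma fg_mulgV : right_inverse fg_one fg_inv fg_mul.
Proof.
move=> u; rewrite -[X in fg_mul X](_ : fg_inv (fg_inv u) = u) ?fg_mulVg //.
by apply/val_inj/word_invK.
Qed.

HB.instance Definition _ :=
  isGroup.Build free_group fg_mulA fg_mul1g fg_mulg1 fg_mulVg fg_mulgV.

Definition fg_gen (x : T) := @FreeGroup [:: (x, false)] isT.

Section Lift.
Variables (G : groupType) (f : T -> G).

Definition letter_val a : G := if a.2 then (f a.1)^-1%g else f a.1.

Definition fg_lift (w : free_group) : G := (\prod_(a <- fg_word w) letter_val a)%g.

Lemma fg_lift_gen x : fg_lift (fg_gen x) = f x.
Proof. by rewrite /fg_lift big_seq1. Qed.

Lemma fg_liftM : {morph fg_lift : u v / (u * v)%g}.
Proof.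
move=> u v; rewrite /fg_lift /= /reduced_cat.
have lV a : letter_val (letter_inv a) = (letter_val a)^-1%g.
  by case: a => x []; rewrite /letter_val /= ?invgK.
elim: (fg_word u) => [|a s IHs] /=; first by rewrite big_nil mul1g.
rewrite big_cons -mulgA -IHs; case: foldr => [|b t] /=.
  by rewrite big_seq1 big_nil mulg1.
by case: eqP => [->|_]; rewrite !big_cons // lV mulVKg.
Qed.

HB.instance Definition _ := isUMagmaMorphism.Build free_group G fg_lift
  (big_nil _ _ _ _, fg_liftM).

Lemma fg_lift_uniq (h : UMagmaMorphism.type free_group G) :
  (forall x, h (fg_gen x) = f x) -> h =1 fg_lift.
Proof.
move=> hf [w]; elim: w => [|[x b] w IHw] rw.
  by rewrite /fg_lift big_nil -[RHS](gmulf1 (s := h)); congr (h _); apply: val_inj.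
have rx : reduced [:: (x, b)] by [].
have -> : FreeGroup rw = (FreeGroup rx * FreeGroup (reduced_behead rw))%g.
  by apply: val_inj => /=; rewrite -(push_cons rw).
rewrite gmulfM fg_liftM IHw; congr (_ * _)%g; rewrite /fg_lift big_seq1 /letter_val /=.
case: b rx {rw} => rx; last first.
  by rewrite -hf; congr (h _); apply: val_inj.
rewrite -hf -gmulfV; congr (h _); exact: val_inj.
Qed.
End Lift.
End FreeGroup.

Section UnitGroup.
Variable R : unitRingType.

Record unit_group := UnitGroup { ug_val :> R; _ : ug_val \is a GRing.unit }.

HB.instance Definition _ := [isSub for ug_val].
HB.instance Definition _ := [Choice of unit_group by <:].

Lemma ug_valP (u : unit_group) : (u : R) \is a GRing.unit. Proof. exact: valP. Qed.

Lemma ug_one_subproof : (1 : R) \is a GRing.unit. Proof. exact: unitr1. Qed.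
Lemma ug_mul_subproof (u v : unit_group) : (u : R) * (v : R) \is a GRing.unit.
Proof. by rewrite unitrMr ug_valP. Qed.
Lemma ug_inv_subproof (u : unit_group) : (u : R)^-1 \is a GRing.unit.
Proof. by rewrite unitrV ug_valP. Qed.

Definition ug_one := UnitGroup ug_one_subproof.
Definition ug_mul u v := UnitGroup (ug_mul_subproof u v).
Definition ug_inv u := UnitGroup (ug_inv_subproof u).

Lemma ug_mulA : associative ug_mul.
Proof. by move=> u v w; apply/val_inj/mulrA. Qed.
Lemma ug_mul1g : left_id ug_one ug_mul.
Proof. by move=> u; apply/val_inj/mul1r. Qed.
Lemma ug_mulg1 : right_id ug_one ug_mul.
Proof. by move=> u; apply/val_inj/mulr1. Qed.
Lemma ug_mulVg : left_inverse ug_one ug_inv ug_mul.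
Proof. by move=> u; apply/val_inj/mulVr/ug_valP. Qed.
Lemma ug_mulgV : right_inverse ug_one ug_inv ug_mul.
Proof. by move=> u; apply/val_inj/divrr/ug_valP. Qed.

HB.instance Definition _ :=
  isGroup.Build unit_group ug_mulA ug_mul1g ug_mulg1 ug_mulVg ug_mulgV.
End UnitGroup.

Section Quaternions.
Variable R : realFieldType.

(* Quat x0 x1 x2 x3 stands for x0 + x1 i + x2 j + x3 k. *)
Record quat := Quat { q_re : R; q_i : R; q_j : R; q_k : R }.

Implicit Types x y z : quat.

Definition quat_tuple x := (q_re x, q_i x, q_j x, q_k x).
Definition quat_of_tuple (t : R * R * R * R) :=
  let: (a, b, c, d) := t in Quat a b c d.
Lemma quat_tupleK : cancel quat_tuple quat_of_tuple. Proof. by case. Qed.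
HB.instance Definition _ := Choice.copy quat (can_type quat_tupleK).

Definition quat_zero := Quat 0 0 0 0.
Definition quat_one := Quat 1 0 0 0.
Definition quat_opp x := Quat (- q_re x) (- q_i x) (- q_j x) (- q_k x).
Definition quat_add x y :=
  Quat (q_re x + q_re y) (q_i x + q_i y) (q_j x + q_j y) (q_k x + q_k y).
Definition quat_mul x y :=
  Quat (q_re x * q_re y - q_i x * q_i y - q_j x * q_j y - q_k x * q_k y)
       (q_re x * q_i y + q_i x * q_re y + q_j x * q_k y - q_k x * q_j y)
       (q_re x * q_j y - q_i x * q_k y + q_j x * q_re y + q_k x * q_i y)
       (q_re x * q_k y + q_i x * q_j y - q_j x * q_i y + q_k x * q_re y).

Lemma quat_eq a b c d a' b' c' d' :
  a = a' -> b = b' -> c = c' -> d = d' -> Quat a b c d = Quat a' b' c' d'.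
Proof. by move=> -> -> -> ->. Qed.

Lemma quat_addA : associative quat_add.
Proof. by move=> [????] [????] [????]; apply: quat_eq => /=; ring. Qed.
Lemma quat_addC : commutative quat_add.
Proof. by move=> [????] [????]; apply: quat_eq => /=; ring. Qed.
Lemma quat_add0 : left_id quat_zero quat_add.
Proof. by move=> [????]; apply: quat_eq => /=; ring. Qed.
Lemma quat_addN : left_inverse quat_zero quat_opp quat_add.
Proof. by move=> [????]; apply: quat_eq => /=; ring. Qed.
Lemma quat_mulA : associative quat_mul.
Proof. by move=> [????] [????] [????]; apply: quat_eq => /=; ring. Qed.
Lemma quat_mul1 : left_id quat_one quat_mul.
Proof. by move=> [????]; apply: quat_eq => /=; ring. Qed.
Lemma quat_mulr1 : right_id quat_one quat_mul.
Proof. by move=> [????]; apply: quat_eq => /=; ring. Qed.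
Lemma quat_mulDl : left_distributive quat_mul quat_add.
Proof. by move=> [????] [????] [????]; apply: quat_eq => /=; ring. Qed.
Lemma quat_mulDr : right_distributive quat_mul quat_add.
Proof. by move=> [????] [????] [????]; apply: quat_eq => /=; ring. Qed.
Lemma quat_one_neq0 : quat_one != quat_zero.
Proof. by apply/eqP => -[] /eqP; rewrite oner_eq0. Qed.

HB.instance Definition _ :=
  GRing.isZmodule.Build quat quat_addA quat_addC quat_add0 quat_addN.
HB.instance Definition _ := GRing.Zmodule_isNzRing.Build quat
  quat_mulA quat_mul1 quat_mulr1 quat_mulDl quat_mulDr quat_one_neq0.

Definition quat_normsq x := q_re x ^+ 2 + q_i x ^+ 2 + q_j x ^+ 2 + q_k x ^+ 2.

(* For x = 0 this is 0, as 0^-1 = 0 in R. *)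
Definition quat_inv x :=
  let n := quat_normsq x in
  Quat (q_re x / n) (- q_i x / n) (- q_j x / n) (- q_k x / n).

Lemma quat_normsq_eq0 x : (quat_normsq x == 0) = (x == 0).
Proof.
case: x => a b c d; rewrite /quat_normsq /=.
rewrite !paddr_eq0 ?addr_ge0 ?sqr_ge0 // !sqrf_eq0.
apply/idP/eqP => [|[-> -> -> ->]]; last by rewrite eqxx.
by move=> /andP[/andP[/andP[/eqP-> /eqP->] /eqP->] /eqP->].
Qed.

Lemma quat_mulVx : {in [pred x | x != 0], left_inverse 1 quat_inv *%R}.
Proof.
move=> x; rewrite inE -quat_normsq_eq0.
case: x => a b c d; rewrite /quat_inv /quat_normsq /= => n0.
by apply: quat_eq => /=; field.
Qed.

Lemma quat_mulxV : {in [pred x | x != 0], right_inverse 1 quat_inv *%R}.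
Proof.
move=> x; rewrite inE -quat_normsq_eq0.
case: x => a b c d; rewrite /quat_inv /quat_normsq /= => n0.
by apply: quat_eq => /=; field.
Qed.

Lemma quat_unitP x y : y * x = 1 /\ x * y = 1 -> x != 0.
Proof. by case=> yx _; apply/eqP => x0; have := oner_neq0 quat; rewrite -yx x0 mulr0 eqxx. Qed.

Lemma quat_inv_out : {in [predC [pred x | x != 0]], quat_inv =1 id}.
Proof.
by move=> x; rewrite !inE negbK => /eqP ->; apply: quat_eq; rewrite /= ?oppr0 mul0r.
Qed.

HB.instance Definition _ := GRing.NzRing_hasMulInverse.Build quat
  quat_mulVx quat_mulxV quat_unitP quat_inv_out.

Lemma quat_unitE x : (x \is a GRing.unit) = (x != 0). Proof. by []. Qed.

Lemma quat_basisE (i := Quat 0 1 0 0) (j := Quat 0 0 1 0) (k := Quat 0 0 0 1) :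
  [/\ i * i = -1, j * j = -1, k * k = -1 & i * j * k = -1].
Proof. by split; apply: quat_eq => /=; ring. Qed.
End Quaternions.

Section Simplex.
Variable R : realType.

Local Notation s := (Num.sqrt 5 / 4 : R).

(* The ordinals 0, 1, 2, 3 index q_1, q_2, q_3, q_4. *)
Definition simplex_quat (n : 'I_4) : quat R :=
  tnth [tuple Quat (- (1 / 4)) s s s;
              Quat (- (1 / 4)) (- s) (- s) s;
              Quat (- (1 / 4)) s (- s) (- s);
              Quat (- (1 / 4)) (- s) s (- s)] n.

Lemma sqr_sqrt5_div4 : s ^+ 2 = 5 / 16.
Proof. by rewrite expr_div_n sqr_sqrtr //; field. Qed.

Lemma simplex_quat_normsq n : quat_normsq (simplex_quat n) = 1.
Proof.
rewrite /simplex_quat; case: n => [[|[|[|[|//]]]] ?];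
  rewrite (tnth_nth 0) /quat_normsq /= ?sqrrN sqr_sqrt5_div4; lra.
Qed.

Lemma simplex_quat_dist1 n : quat_normsq (simplex_quat n - 1) = 5 / 2.
Proof.
rewrite /simplex_quat; case: n => [[|[|[|[|//]]]] ?];
  rewrite (tnth_nth 0) /quat_normsq /= ?subr0 ?sqrrN sqr_sqrt5_div4; lra.
Qed.

Lemma simplex_quat_dist m n : m != n ->
  quat_normsq (simplex_quat m - simplex_quat n) = 5 / 2.
Proof.
rewrite /simplex_quat; case: m n => [[|[|[|[|//]]]] ?] [[|[|[|[|//]]]] ?] //= _;
  rewrite !(tnth_nth 0) /quat_normsq /=; have := sqr_sqrt5_div4; nra.
Qed.

Lemma simplex_quat_unit n : simplex_quat n \is a GRing.unit.
Proof. by rewrite quat_unitE -quat_normsq_eq0 simplex_quat_normsq oner_eq0. Qed.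

Definition simplex_unit (n : 'I_4) : unit_group (quat R) :=
  UnitGroup (simplex_quat_unit n).
End Simplex.

(* Main.v *)
(* Write r_0 = 1 - i and r_n = (1 - i) q_n. These five quaternions lie in the
   icosian ring I over Z[phi], have norm 2, and since the q_n form a regular
   simplex their differences have norm 5, which is odd. Hence if r_m y and r_n y
   both lie in 2I for some m <> n, then
   5y = conj(r_m - r_n) (r_m y - r_n y) lies in 2I, and so does y; the same holds
   for the conjugates of the r_n. Now 2 q_n = conj(r_0) r_n and
   2 q_n^-1 = conj(r_n) r_0, so a reduced word in the q_n is, up to powers of 2,
   a product alternating between the r's and their conjugates in which
   neighbours have distinct indices (r_0 conj(r_0) = 2 is cancelled). Such a
   product never lies in 2I. For a word of value 1 it would be 2^k or 2^k r_0;
   this leaves k = 0, where the first letter of the word gives a contradiction. *)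
Require Import Defs.
From HB Require Import structures.
From mathcomp Require Import all_boot all_order all_algebra.
From mathcomp Require Import boolp reals.
From mathcomp Require Import ring lra zify.

Set Implicit Arguments.
Unset Strict Implicit.
Unset Printing Implicit Defensive.

Import Order.TTheory GRing.Theory Num.Theory.
Local Open Scope ring_scope.

(** * Quaternion conjugation and norm *)

Section QuaternionConjugation.
Variable R : realFieldType.
Implicit Types x y : quat R.

Definition quat_conj x := Quat (q_re x) (- q_i x) (- q_j x) (- q_k x).

Definition quat_real (a : R) := Quat a 0 0 0.

Lemma quat_realD a b : quat_real (a + b) = quat_real a + quat_real b.
Proof. by apply: quat_eq => /=; ring. Qed.

Lemma quat_real_nat n : quat_real n%:R = n%:R.
Proof. by elim: n => [|n IHn] //; rewrite !mulrSr quat_realD IHn. Qed.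

Lemma quat_conjB : {morph quat_conj : x y / x - y}.
Proof. by move=> [????] [????]; apply: quat_eq => /=; ring. Qed.

Lemma quat_mul_conj x : x * quat_conj x = quat_real (quat_normsq x).
Proof. by case: x => ????; apply: quat_eq; rewrite /quat_normsq /=; ring. Qed.

Lemma quat_conj_mul x : quat_conj x * x = quat_real (quat_normsq x).
Proof. by case: x => ????; apply: quat_eq; rewrite /quat_normsq /=; ring. Qed.

Lemma quat_normsqM x y : quat_normsq (x * y) = quat_normsq x * quat_normsq y.
Proof. by case: x y => [????] [????]; rewrite /quat_normsq /=; ring. Qed.

End QuaternionConjugation.

Section Icosians.
Variable R : realType.

(** * The ring Z[phi] of golden integers *)

Definition phi : R := (1 + Num.sqrt 5) / 2.

Lemma phi2 : phi * phi = phi + 1.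
Proof.
have : Num.sqrt 5 ^+ 2 = 5 :> R by rewrite sqr_sqrtr.
by rewrite /phi => s2; field: s2.
Qed.

(** Boolean, so that it can carry a canonical subring structure. *)
Definition golden_pred (x : R) : bool :=
  `[< exists a b : int, x = a%:~R + b%:~R * phi >].

Definition golden := [qualify a x | golden_pred x].

Lemma goldenP x :
  reflect (exists a b : int, x = a%:~R + b%:~R * phi) (x \is a golden).
Proof. exact: asboolP. Qed.

Fact golden_subring_closed : subring_closed golden.
Proof.
split=> [|x y|x y].
- by apply/goldenP; exists 1, 0; rewrite mul0r addr0.
- move=> /goldenP[a [b ->]] /goldenP[c [d ->]]; apply/goldenP.
  by exists (a - c), (b - d); rewrite !rmorphB /=; ring.
- move=> /goldenP[a [b ->]] /goldenP[c [d ->]]; apply/goldenP.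
  exists (a * c + b * d), (a * d + b * c + b * d).
  by rewrite !rmorphD !rmorphM /=; ring: phi2.
Qed.
HB.instance Definition _ :=
  GRing.isSubringClosed.Build R golden_pred golden_subring_closed.

Lemma phi_golden : phi \is a golden.
Proof. by apply/goldenP; exists 0, 1; rewrite mul1r add0r. Qed.

Lemma half_not_golden : 2^-1 \isn't a golden.
Proof.
apply/goldenP => -[a [b h]].
have /eqP : (((2 * a + b - 1) ^+ 2)%:~R : R) = (5 * b ^+ 2)%:~R.
  have s2 : Num.sqrt 5 ^+ 2 = 5 :> R by rewrite sqr_sqrtr.
  have e : 2 * a%:~R + b%:~R - 1 = - b%:~R * Num.sqrt 5 :> R.
    move: h; rewrite /phi => h; lra.
  rewrite !expr2 !rmorphM rmorphB rmorphD rmorphM /= e.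
  by ring: s2.
rewrite eqr_int => /eqP e.
have : (2 * a + b - 1) ^+ 2 - 5 * b ^+ 2 = 0 by rewrite e subrr.
(* [2 * a + b - 1] and [b] have opposite parity, hence so do the two terms of the difference. *)
have [q [-> | ->]] : exists q : int, b = 2 * q \/ b = 2 * q + 1.
  exists (b %/ 2)%Z; lia.
all: rewrite !expr2; nia.
Qed.

(** * The icosian ring *)

(* Coordinates with respect to 1, i, (1+i+j+k)/2, ((phi-1) + phi i + j)/2, a
   basis of the icosian ring over Z[phi]. *)
Definition icosian_comb (a b c d : R) : quat R :=
  Quat (a + (c + (phi - 1) * d) / 2) (b + (c + phi * d) / 2)
       ((c + d) / 2) (c / 2).

Definition icosian_pred (x : quat R) : bool := `[< exists a b c d : R,
  [/\ a \is a golden, b \is a golden, c \is a golden & d \is a golden]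
  /\ x = icosian_comb a b c d >].

Definition icosian := [qualify a x | icosian_pred x].

Lemma icosianP x : reflect (exists a b c d : R,
  [/\ a \is a golden, b \is a golden, c \is a golden & d \is a golden]
  /\ x = icosian_comb a b c d) (x \is a icosian).
Proof. exact: asboolP. Qed.

Lemma icosian_combP a b c d : a \is a golden -> b \is a golden ->
  c \is a golden -> d \is a golden -> icosian_comb a b c d \is a icosian.
Proof. by move=> ????; apply/icosianP; exists a, b, c, d. Qed.

(* The closure lemmas leave goals about the canonical structure of golden_pred, to
   which the next closure lemma does not apply until [golden] is restored. *)
Ltac golden_apply lem :=
  apply: lem;
  match goal with |- is_true (in_mem ?x _) => change (is_true (x \is a golden)) end.

Ltac golden := repeat first
  [ assumption | exact: phi_golden | exact: rpred0 | exact: rpred1 | exact: rpred_nat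
  | golden_apply rpredB | golden_apply rpredD | golden_apply rpredNr
  | golden_apply rpredM ].

Lemma icosian_combD a b c d a' b' c' d' :
  icosian_comb a b c d + icosian_comb a' b' c' d'
  = icosian_comb (a + a') (b + b') (c + c') (d + d').
Proof. by apply: quat_eq => /=; field. Qed.

Lemma icosian_combN a b c d :
  - icosian_comb a b c d = icosian_comb (- a) (- b) (- c) (- d).
Proof. by apply: quat_eq => /=; field. Qed.

Lemma icosian_combZ s a b c d :
  quat_real s * icosian_comb a b c d = icosian_comb (s * a) (s * b) (s * c) (s * d).
Proof. by apply: quat_eq => /=; field. Qed.

Lemma icosian_combE a b c d : icosian_comb a b c d =
  quat_real a + quat_real b * icosian_comb 0 1 0 0 +
  quat_real c * icosian_comb 0 0 1 0 + quat_real d * icosian_comb 0 0 0 1.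
Proof. by apply: quat_eq => /=; field. Qed.

(** Closure under products reduces to left multiplication by the three basis elements other than 1;
    it holds because all coefficients here and in the next two lemmas lie in Z[phi]. *)
Lemma icosian_mul_i a b c d : icosian_comb 0 1 0 0 * icosian_comb a b c d =
  icosian_comb (- b + (phi - 2) * c - d) (a + phi * c + (phi - 1) * d)
               (c + d) (- 2 * c - d).
Proof. by apply: quat_eq => /=; field: phi2. Qed.

Lemma icosian_mul_w a b c d : icosian_comb 0 0 1 0 * icosian_comb a b c d =
  icosian_comb ((1 - phi) * b - c - d) ((1 - phi) * b - d)
               (a - b + c) (2 * b + phi * d).
Proof. by apply: quat_eq => /=; field: phi2. Qed.

Lemma icosian_mul_t a b c d : icosian_comb 0 0 0 1 * icosian_comb a b c d =
  icosian_comb ((1 - phi) * b + (1 - phi) * c - d) c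
    (- b + (phi - 1) * c) (a + b + (1 - phi) * c + (phi - 1) * d).
Proof. by apply: quat_eq => /=; field: phi2. Qed.

Fact icosian_subring_closed : subring_closed icosian.
Proof.
split=> [|x y|x y].
- have -> : 1 = icosian_comb 1 0 0 0 by apply: quat_eq; field.
  by apply: icosian_combP; golden.
- move=> /icosianP[a [b [c [d [[????] ->]]]]].
  move=> /icosianP[a' [b' [c' [d' [[????] ->]]]]].
  by rewrite icosian_combN icosian_combD; apply: icosian_combP; golden.
- move=> /icosianP[a [b [c [d [[????] ->]]]]].
  move=> /icosianP[a' [b' [c' [d' [[????] ->]]]]].
  rewrite (icosian_combE a) !mulrDl -!(mulrA (quat_real _)).
  rewrite icosian_mul_i icosian_mul_w icosian_mul_t !icosian_combZ !icosian_combD.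
  by apply: icosian_combP; golden.
Qed.
HB.instance Definition _ :=
  GRing.isSubringClosed.Build (quat R) icosian_pred icosian_subring_closed.

(** A conjugate is the trace minus the element, and the trace [2 * a + c + (phi - 1) * d] lies in
    Z[phi]. *)
Lemma icosian_conj x : x \is a icosian -> quat_conj x \is a icosian.
Proof.
move=> /icosianP[a [b [c [d [[????] ->]]]]].
have -> : quat_conj (icosian_comb a b c d) =
    icosian_comb (a + c + (phi - 1) * d) (- b) (- c) (- d).
  by apply: quat_eq => /=; field.
by apply: icosian_combP; golden.
Qed.

Lemma half_not_icosian : quat_real 2^-1 \isn't a icosian.
Proof.
apply/icosianP => -[a [b [c [d [[ga _ _ _]]]]]] [e0 _ e2 e3].
have c0 : c = 0 by lra.
have d0 : d = 0 by lra.
move: e0; rewrite c0 d0 mulr0 addr0 mul0r addr0 => e0.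
by move: half_not_golden; rewrite e0 ga.
Qed.

(** * The simplex vertices as icosians *)

(* [None] stands for the vertex q_0 = 1 of the simplex, [Some n] for
   [simplex_quat n]; the factor 1 - i makes all five products icosians. *)
Definition vertex (n : option 'I_4) : quat R :=
  Quat 1 (- 1) 0 0 * oapp (simplex_quat R) 1 n.

Lemma vertex_icosian n : vertex n \is a icosian.
Proof.
have s2 : Num.sqrt 5 * Num.sqrt 5 = 5 :> R by rewrite -expr2 sqr_sqrtr.
rewrite /vertex; case: n => [[[|[|[|[|//]]]] i4]|] /=.
all: rewrite /simplex_quat ?(tnth_nth 0) /=.
(* The witnesses are solved for from the k-coordinate backwards, using sqrt 5 = 2 phi - 1. *)
- rewrite (_ : _ * _ = icosian_comb (phi - 2) (- 1) 0 (2 * phi - 1)).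
    by apply: icosian_combP; golden.
  by apply: quat_eq; rewrite /= /phi; field: s2.
- rewrite (_ : _ * _ = icosian_comb (2 - 2 * phi) (2 - phi) (2 * phi - 1) (1 - 2 * phi)).
    by apply: icosian_combP; golden.
  by apply: quat_eq; rewrite /= /phi; field: s2.
- rewrite (_ : _ * _ = icosian_comb 1 (1 + phi) 0 (1 - 2 * phi)).
    by apply: icosian_combP; golden.
  by apply: quat_eq; rewrite /= /phi; field: s2.
- rewrite (_ : _ * _ = icosian_comb (phi - 2) (- 1) (1 - 2 * phi) (2 * phi - 1)).
    by apply: icosian_combP; golden.
  by apply: quat_eq; rewrite /= /phi; field: s2.
- rewrite mulr1 (_ : Quat _ _ _ _ = icosian_comb 1 (- 1) 0 0).
    by apply: icosian_combP; golden.
  by apply: quat_eq => /=; field.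
Qed.

(** * Divisibility by 2 among the icosians *)

Implicit Types (x y : quat R).

Definition even_icosian x := exists2 y, y \is a icosian & x = y *+ 2.

Lemma even_icosianB x y :
  even_icosian x -> even_icosian y -> even_icosian (x - y).
Proof.
by move=> [a aI ->] [b bI ->]; exists (a - b); [exact: rpredB | rewrite mulrnBl].
Qed.

Lemma even_icosianM x y : x \is a icosian -> even_icosian y -> even_icosian (x * y).
Proof. by move=> xI [b bI ->]; exists (x * b); [exact: rpredM | rewrite mulrnAr]. Qed.

Lemma even_icosian_double x : x \is a icosian -> even_icosian (x *+ 2).
Proof. by exists x. Qed.

Lemma even_icosian5 x :
  x \is a icosian -> even_icosian (x *+ 5) -> even_icosian x.
Proof.
move=> xI e; have -> : x = x *+ 5 - x *+ 2 *+ 2.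
  by rewrite -mulrnA -mulrnBr.
by apply: even_icosianB e (even_icosian_double _); rewrite rpredMn.
Qed.

Lemma even_icosian_pow2 k x : x \is a icosian -> (0 < k)%N ->
  even_icosian (x *+ 2 ^ k).
Proof.
case: k => // k xI _; rewrite expnSr mulrnA.
by apply: even_icosian_double; rewrite rpredMn.
Qed.

Lemma vertex_norm n : quat_normsq (vertex n) = 2.
Proof.
rewrite quat_normsqM.
have -> : quat_normsq (oapp (simplex_quat R) 1 n) = 1.
  case: n => [n|] /=; first exact: simplex_quat_normsq.
  by rewrite /quat_normsq /=; ring.
by rewrite /quat_normsq /=; ring.
Qed.

(** The common factor 1 - i has norm 2 and doubles the squared edge length 5/2. *)
Lemma vertex_dist m n : m != n -> quat_normsq (vertex m - vertex n) = 5.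
Proof.
move=> mn; rewrite /vertex -mulrBr quat_normsqM.
have -> : quat_normsq (oapp (simplex_quat R) 1 m - oapp (simplex_quat R) 1 n) = 5 / 2.
  case: m n mn => [m|] [n|] //= mn.
  - exact: simplex_quat_dist.
  - exact: simplex_quat_dist1.
  - rewrite -(simplex_quat_dist1 R n); case: (simplex_quat R n) => ????.
    by rewrite /quat_normsq /=; ring.
by rewrite /quat_normsq /=; field.
Qed.

Local Notation vertex' n := (quat_conj (vertex n)).

Lemma vertex_conj_icosian n : vertex' n \is a icosian.
Proof. exact/icosian_conj/vertex_icosian. Qed.

Lemma vertex_conjK n x : vertex' n * (vertex n * x) = x *+ 2.
Proof. by rewrite mulrA quat_conj_mul vertex_norm quat_real_nat mulr_natl. Qed.

Lemma vertexK n x : vertex n * (vertex' n * x) = x *+ 2.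
Proof. by rewrite mulrA quat_mul_conj vertex_norm quat_real_nat mulr_natl. Qed.

Lemma vertex_even_inj m n y : y \is a icosian -> m != n ->
  even_icosian (vertex m * y) -> even_icosian (vertex n * y) -> even_icosian y.
Proof.
move=> yI mn em en; apply: even_icosian5 => //.
have -> : y *+ 5 = (vertex' m - vertex' n) * (vertex m * y - vertex n * y).
  rewrite -mulrBl mulrA -quat_conjB quat_conj_mul vertex_dist //.
  by rewrite quat_real_nat mulr_natl.
apply: even_icosianM; last exact: even_icosianB.
by rewrite rpredB ?vertex_conj_icosian.
Qed.

Lemma vertex_conj_even_inj m n y : y \is a icosian -> m != n ->
  even_icosian (vertex' m * y) -> even_icosian (vertex' n * y) -> even_icosian y.
Proof.
move=> yI mn em en; apply: even_icosian5 => //.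
have -> : y *+ 5 = (vertex m - vertex n) * (vertex' m * y - vertex' n * y).
  rewrite -mulrBl mulrA -quat_conjB quat_mul_conj vertex_dist //.
  by rewrite quat_real_nat mulr_natl.
apply: even_icosianM; last exact: even_icosianB.
by rewrite rpredB ?vertex_icosian.
Qed.

(** If r_n = 2y, then y has norm 1/2, and y conj(y) = 1/2 would be an icosian. *)
Lemma vertex_not_even n : ~ even_icosian (vertex n).
Proof.
move=> [y yI e]; have := half_not_icosian.
suff -> : quat_real 2^-1 = y * quat_conj y by rewrite rpredM ?icosian_conj.
rewrite quat_mul_conj; congr quat_real.
have : quat_normsq (y *+ 2) = 2 by rewrite -e vertex_norm.
by rewrite /quat_normsq mulr2n /=; nra.
Qed.

(** * Words in the q_n and the ping-pong invariant *)

Definition word_val (w : seq ('I_4 * bool)) : quat R :=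
  \prod_(a <- w) ug_val (letter_val (simplex_unit R) a).

Lemma word_val_false (n : 'I_4) w :
  vertex None * word_val ((n, false) :: w) = vertex (Some n) * word_val w.
Proof. by rewrite /word_val big_cons mulrA /letter_val /= /vertex /= mulr1. Qed.

Lemma word_val_true (n : 'I_4) w :
  word_val ((n, true) :: w) *+ 2 = vertex' (Some n) * (vertex None * word_val w).
Proof.
rewrite /word_val big_cons /letter_val /=; set v := \prod_(a <- w) _.
have -> : vertex None = vertex (Some n) * (simplex_quat R n)^-1.
  by rewrite /vertex /= mulr1 mulrK ?simplex_quat_unit.
by rewrite -(mulrA (vertex (Some n))) vertex_conjK.
Qed.

(* Multiplying a word by a new first letter preserves non-evenness unless the
   leading factor cancels; the last conjunct remembers that factor. For a leading
   generator the invariant is about r_0 times the word, so that the leading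
   factor is r_n and not the conjugate of r_0 shared by all generators. *)
Definition pingpong (w : seq ('I_4 * bool)) : Prop :=
  match w with
  | [::] => True
  | (n, true) :: _ => exists k (y := word_val w *+ 2 ^ k),
      [/\ y \is a icosian, ~ even_icosian y & even_icosian (vertex (Some n) * y)]
  | (n, false) :: _ => exists k (z := vertex None * word_val w *+ 2 ^ k),
      [/\ z \is a icosian, ~ even_icosian z & even_icosian (vertex' (Some n) * z)]
  end.

(** Prepares the prefixing of q_n^-1, whose factor conj(r_n) must not make the product even. *)
Lemma pingpong_true (n : 'I_4) w : ohead w != Some (n, false) -> pingpong w ->
  exists k (z := vertex None * word_val w *+ 2 ^ k),
    [/\ z \is a icosian, ~ even_icosian z & ~ even_icosian (vertex' (Some n) * z)].
Proof.
case: w => [_ _|[m []] w /= hd [k [yI ny ey]]].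
- exists 0; rewrite /word_val big_nil mulr1 mulr1n; split.
  + exact: vertex_icosian.
  + exact: vertex_not_even.
  + move=> e; apply: (@vertex_not_even None).
    apply: (@vertex_conj_even_inj None (Some n)) => //; first exact: vertex_icosian.
    by rewrite -[X in _ * X]mulr1 vertex_conjK; apply/even_icosian_double/rpred1.
- exists k; rewrite -mulrnAr.
  (* As r_m y is even, r_0 y is not; then conj(r_0) r_0 y = 2y is even, so conj(r_n) r_0 y is
     not. *)
  have nz : ~ even_icosian (vertex None * (word_val ((m, true) :: w) *+ 2 ^ k)).
    by move=> e; apply: ny; apply: (@vertex_even_inj None (Some m)).
  split=> //; first by rewrite rpredM ?vertex_icosian.
  move=> e; apply: nz.
  apply: (@vertex_conj_even_inj None (Some n)) => //.
    by rewrite rpredM ?vertex_icosian.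
  by rewrite vertex_conjK; apply: even_icosian_double.
- exists k; split=> // e; apply: ny.
  apply: (@vertex_conj_even_inj (Some m) (Some n)) => //.
  by apply: contraNneq hd => -[->].
Qed.

Lemma pingpong_false (n : 'I_4) w : ohead w != Some (n, true) -> pingpong w ->
  exists k (y := word_val w *+ 2 ^ k),
    [/\ y \is a icosian, ~ even_icosian y & ~ even_icosian (vertex (Some n) * y)].
Proof.
case: w => [_ _|[m []] w /= hd [k [zI nz ez]]].
- exists 0; rewrite /word_val big_nil mulr1n mulr1; split.
  + exact: rpred1.
  + by move=> e; apply: (@vertex_not_even None); rewrite -[vertex None]mulr1;
      apply: even_icosianM e; apply: vertex_icosian.
  + exact: vertex_not_even.
- exists k; split=> // e; apply: nz.
  apply: (@vertex_even_inj (Some m) (Some n)) => //.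
  by apply: contraNneq hd => -[->].
(* The leading r_0 of z is removed by conj(r_0), which leaves one more factor 2. *)
- exists k.+1; set z := (_ *+ _) in zI nz ez.
  have -> : word_val ((m, false) :: w) *+ 2 ^ k.+1 = vertex' None * z.
    by rewrite /z mulrnAr vertex_conjK -mulrnA expnS.
  have ny : ~ even_icosian (vertex' None * z).
    by move=> e; apply: nz; apply: (@vertex_conj_even_inj None (Some m)).
  have yI : vertex' None * z \is a icosian by rewrite rpredM ?vertex_conj_icosian.
  split=> // e; apply: ny; apply: (@vertex_even_inj None (Some n)) => //.
  by rewrite vertexK; apply: even_icosian_double.
Qed.

Lemma reduced_pingpong w : reduced w -> pingpong w.
Proof.
elim: w => [//|[n b] w IHw] rw.
have sw := IHw (reduced_behead rw).
have hd : ohead w != Some (n, ~~ b).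
  by case: w rw {IHw sw} => [//|a w] /andP[/= ha _]; apply: contraNneq ha => -[->].
case: b rw hd => rw hd.
- have [k [zI nz nez]] := pingpong_true hd sw.
  (* The extra factor 2 is spent on 2 q_n^-1 = conj(r_n) r_0. *)
  exists k.+1; rewrite expnS mulrnA word_val_true -mulrnAr.
  split=> //; first by rewrite rpredM ?vertex_conj_icosian.
  by rewrite vertexK; apply: even_icosian_double.
- have [k [yI ny ney]] := pingpong_false hd sw.
  exists k; rewrite word_val_false -mulrnAr.
  split=> //; first by rewrite rpredM ?vertex_icosian.
  by rewrite vertex_conjK; apply: even_icosian_double.
Qed.

Lemma reduced_word_val_neq1 w : reduced w -> w != [::] -> word_val w != 1.
Proof.
move=> /reduced_pingpong sw w0; apply/eqP => v1; move: sw w0.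
case: w v1 => [//|[n []] w] /= -> [[|k] [_ ny ey]] _.
- by apply: (@vertex_not_even (Some n)); rewrite -[vertex _]mulr1.
- by apply: ny; apply: even_icosian_pow2 => //; apply: rpred1.
(* Both conj(r_n) r_0 and conj(r_0) r_0 = 2 are even, so r_0 would be even. *)
- apply: ny; rewrite mulr1 mulr1n in ey *.
  apply: (@vertex_conj_even_inj None (Some n)) => //; first exact: vertex_icosian.
  by rewrite -[X in _ * X]mulr1 vertex_conjK; apply/even_icosian_double/rpred1.
- by apply: ny; apply: even_icosian_pow2 => //; rewrite mulr1 vertex_icosian.
Qed.

Lemma fg_lift_word_val (w : free_group 'I_4) :
  ug_val (fg_lift (simplex_unit R) w) = word_val w.
Proof.
rewrite /fg_lift /word_val.
by elim: (fg_word w) => [|a s IHs]; rewrite ?big_nil // !big_cons -IHs.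
Qed.

End Icosians.

Theorem theorem1 (R : realType) :
  injective (fg_lift (simplex_unit R) : free_group 'I_4 -> unit_group (quat R)).
Proof.
move=> u v uv; apply/eqP; rewrite -(inj_eq (mulgI u^-1%g)) mulVg eq_sym.
apply/negPn/negP => ne.
have := reduced_word_val_neq1 R (fg_wordP (u^-1 * v)%g).
by rewrite -fg_lift_word_val fg_liftM -uv -fg_liftM mulVg /fg_lift big_nil eqxx => /(_ ne).
Qed.
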